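(* Let $\mathfrak X$ be a circulant ternary coherent configuration on a finite set $\Omega$ with $|\Omega|$ prime. If $\mathfrak X$ is not an association scheme on triples, then $\mathfrak X$ is schurian.
   Context: Let $\Omega$ be a finite set and $M=\{1,2,3\}$. For $x=(x_1,x_2,x_3)\in\Omega^3$, let $\rho(x)$ be the equivalence relation on $M$ with $i\sim j$ iff $x_i=x_j$. For a map $\sigma:M\to M$ put $x^\sigma=(x_{1^\sigma},x_{2^\sigma},x_{3^\sigma})$, and for $X\subseteq\Omega^3$ put $X^\sigma=\{x^\sigma:x\in X\}$. For $i\in M$ and $\alpha\in\Omega$, $x_{i\leftarrow\alpha}$ is the triple obtained from $x$ by replacing its $i$th coordinate with $\alpha$. A partition $\mathfrak X$ of $\Omega^3$ is a ternary coherent configuration on $\Omega$ if for every class $X\in\mathfrak X$: (C1) $\rho(x)$ is the same for all $x\in X$ (denote it $\rho(X)$); (C2) $X^\sigma\in\mathfrak X$ for every map $\sigma:M\to M$; (C3) for any $X_1,X_2,X_3\in\mathfrak X$ the number $|\{\alpha\in\Omega: x_{i\leftarrow\alpha}\in X_i \text{ for all } i\in M\}|$ does not depend on the choice of $x\in X$. The order of $\mathfrak X$ is $|\Omega|$. The automorphism group $\mathrm{Aut}(\mathfrak X)$ is the group of all permutations $f$ of $\Omega$ with $X^f=X$ for every class $X$, where $f$ acts on triples componentwise. $\mathfrak X$ is circulant if $\mathrm{Aut}(\mathfrak X)$ contains a cyclic subgroup acting regularly on $\Omega$. $\mathfrak X$ is schurian if $\mathfrak X=\mathrm{Orb}_3(G)$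 for some $G\le\mathrm{Sym}(\Omega)$, where $\mathrm{Orb}_3(G)$ is the partition of $\Omega^3$ into the orbits of $G$ acting componentwise. $\mathfrak X$ is an association scheme on triples if for every equivalence relation $\rho$ on $M$ with at most two classes there is exactly one class $X\in\mathfrak X$ with $\rho(X)=\rho$. *)

(* Defs.v *)
From HB Require Import structures.
From mathcomp Require Import all_boot all_fingroup all_solvable.

Set Implicit Arguments.
Unset Strict Implicit.
Unset Printing Implicit Defensive.

Local Open Scope group_scope.

(* The index set M = {1,2,3} is rendered as 'I_3 = {0,1,2}. *)
Notation triple T := {ffun 'I_3 -> T}.

Section Triples.
Variable T : finType.
Implicit Types (x : triple T) (X : {set triple T}) (f : {perm T}).

Definition rho x : rel 'I_3 := fun i j => x i == x j.

Definition tmap (s : 'I_3 -> 'I_3) x : triple T := [ffun i => x (s i)].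

Definition tmap_set (s : 'I_3 -> 'I_3) X : {set triple T} :=
  [set tmap s x | x in X].

Definition tsubst x (i : 'I_3) (a : T) : triple T :=
  [ffun j => if j == i then a else x j].

Definition tact x f : triple T := [ffun i => f (x i)].

Lemma tact1 : tact^~ 1 =1 id.
Proof. by move=> x; apply/ffunP=> i; rewrite ffunE perm1. Qed.

Lemma tactM x : act_morph tact x.
Proof. by move=> f g; apply/ffunP=> i; rewrite !ffunE permM. Qed.

Canonical triple_action := TotalAction tact1 tactM.

Definition Orb3 (G : {set {perm T}}) : {set {set triple T}} :=
  orbit triple_action G @: [set: triple T].

End Triples.

Section Configurations.
Variable T : finType.
Implicit Types (P : {set {set triple T}}) (X : {set triple T}).

(* rho(X) = e; classes of a partition are nonempty, so e is determined by X. *)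
Definition class_rho X (e : rel 'I_3) : Prop :=
  forall x, x \in X -> rho x =2 e.

Definition C1 P : Prop :=
  forall X, X \in P -> forall x y, x \in X -> y \in X -> rho x =2 rho y.

Definition C2 P : Prop :=
  forall X, X \in P -> forall s : 'I_3 -> 'I_3, tmap_set s X \in P.

Definition C3 P : Prop :=
  forall X, X \in P ->
  forall Y : 'I_3 -> {set triple T}, (forall i, Y i \in P) ->
  forall x y, x \in X -> y \in X ->
    #|[set a : T | [forall i, tsubst x i a \in Y i]]|
    = #|[set a : T | [forall i, tsubst y i a \in Y i]]|.

Definition ternary_cc P : Prop :=
  [/\ partition P [set: triple T], C1 P, C2 P & C3 P].

Definition cc_aut P : {set {perm T}} :=
  [set f : {perm T} | [forall (X | X \in P), (triple_action T)^* X f == X]].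

Lemma cc_aut_group_set P : group_set (cc_aut P).
Proof.
apply/group_setP; split=> [|f g].
  by rewrite inE; apply/forall_inP=> X _; rewrite act1.
rewrite !inE => /forall_inP Pf /forall_inP Pg; apply/forall_inP=> X PX.
by rewrite actM; move: (Pf X PX) => /= /eqP ->; apply: Pg.
Qed.

Canonical cc_aut_group P := Group (cc_aut_group_set P).

Definition acts_regularly (G : {set {perm T}}) : Prop :=
  [transitive G, on [set: T] | 'P] /\ forall a : T, 'C_G[a | 'P] = 1.

Definition circulant P : Prop :=
  exists C : {group {perm T}},
    [/\ C \subset cc_aut P, cyclic C & acts_regularly C].

Definition schurian P : Prop := exists G : {group {perm T}}, P = Orb3 G.

Definition assoc_scheme_on_triples P : Prop :=
  forall e : rel 'I_3, equivalence_rel e ->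
    #|equivalence_partition e [set: 'I_3]| <= 2 ->
    exists! X : {set triple T}, X \in P /\ class_rho X e.

End Configurations.

(* Main.v *)
Require Import Defs.
From mathcomp Require Import all_boot all_fingroup all_solvable.
From mathcomp Require Import all_algebra finfield zify ring.

(* Identify Omega with F_p so that the regular cyclic group acts by translations,
   and consider the algebra of F_p-valued functions on triples that are constant
   on classes; sums over F_p are evaluated by power sums. Since the configuration
   is not an association scheme on triples, some nonconstant polynomial of degree
   < p - 1 in z - x is a class function, and one of least degree has to be
   a (z - x)^k + c with 0 < k < p - 1. The binary forms
   sum_b c_b (y - x)^b (z - x)^(k - b) that are class functions form an algebra
   under the coefficientwise product, stable under exchanging x and y; it contains
   (z - y)^k. If this algebra did not separate the index b = 1 from all others, then
   comparing coefficients at 1 and at the next index not separated from it would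
   force k = -1 mod p; so (y - x) (z - x)^(k - 1) is a class function. Hence for
   x <> z the class of (x, y, z) determines y from x and z, so every pair of
   triples in one class extends, point by point via (C3), to an automorphism. *)

Set Implicit Arguments.
Unset Strict Implicit.
Unset Printing Implicit Defensive.

Import GRing.Theory.

(** * Power sums and convolution of polynomials over the prime field *)

Section PrimeFieldSums.
Local Open Scope ring_scope.
Variables (p : nat) (p_pr : prime p).
Local Notation F := 'F_p.

Lemma natF_eq0 n : ((n%:R : F) == 0) = (p %| n)%N.
Proof. by rewrite (dvdn_pcharf (pchar_Fp p_pr)). Qed.

Lemma natF_neq0 n : (0 < n < p)%N -> (n%:R : F) != 0.
Proof. by case/andP=> n0 np; rewrite natF_eq0 gtnNdvd. Qed.

Lemma natF_inj m n : (m < p)%N -> (n < p)%N -> (m%:R : F) = n%:R -> m = n.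
Proof.
move=> mp np /eqP; wlog le_nm : m n mp np / (n <= m)%N.
  move=> W; case/orP: (leq_total n m) => le; first exact: W.
  by rewrite eq_sym => h; symmetry; apply: W h.
rewrite -subr_eq0 -natrB // natF_eq0 => /dvdn_leq; lia.
Qed.

(** The binomial coefficient divides n!, a product of positive integers below [p]. *)
Lemma binF_neq0 n m : (n < p)%N -> (m <= n)%N -> ('C(n, m)%:R : F) != 0.
Proof.
move=> np le_mn; rewrite natF_eq0; apply/negP=> pC.
have : (p %| n`!)%N by rewrite -(bin_fact le_mn) dvdn_mulr.
elim: n np {le_mn pC} => [|n IH] np; first by rewrite fact0 gtnNdvd // prime_gt1.
by rewrite factS Euclid_dvdM // gtnNdvd //=; apply: IH; apply: ltnW.
Qed.

Lemma expF_pred (a : F) : a ^+ p.-1 = (a != 0)%:R.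
Proof.
have [->|a0] := eqVneq a 0; first by rewrite expr0n; case: p p_pr => [|[|]].
apply: (mulIf a0); rewrite mul1r -exprSr prednK ?prime_gt0 //.
by have := expf_card a; rewrite card_Fp.
Qed.

(** The polynomial X^n - 1 has at most [n] roots, fewer than the p - 1 nonzero elements. *)
Lemma expF_neq1 n : (0 < n < p.-1)%N -> exists2 g : F, g != 0 & g ^+ n != 1.
Proof.
move=> /andP[n0 np]; apply/exists_inP; apply: contraT => /exists_inPn H; exfalso.
have Xn1 : 'X^n - 1 != 0 :> {poly F} by rewrite -size_poly_eq0 size_XnsubC.
have := max_poly_roots Xn1 _ (enum_uniq [pred g : F | g != 0]).
rewrite size_XnsubC // -cardE => lt.
suff {lt}/lt : all (root ('X^n - 1)) (enum [pred g : F | g != 0]).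
  rewrite (eq_card (B := predC1 0)) // cardC1 (card_Fp p_pr); lia.
apply/allP=> g; rewrite mem_enum inE => g0; rewrite rootE !hornerE.
by move/negPn/eqP: (H g g0) ->; rewrite subrr.
Qed.

(** Multiplying by [g] with g^n <> 1 permutes the field and rescales the sum, which is therefore 0.
    Below 2(p - 1) the only exceptional exponent is p - 1: for [n = 0] the convention 0^0 = 1 gives
    p = 0. *)
Lemma sum_expF n : (n < p.-1.*2)%N ->
  \sum_(a : F) a ^+ n = - (n == p.-1)%:R.
Proof.
have p2 := prime_gt1 p_pr.
have small m : (0 < m < p.-1)%N -> \sum_(a : F) a ^+ m = 0.
  move=> /expF_neq1[g g0 gm]; have := subr_eq0 (g ^+ m) 1; rewrite (negPf gm).
  set S := \sum_a _; have SE : g ^+ m * S = S.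
    rewrite mulr_sumr [RHS](reindex_inj (mulfI g0)).
    by apply: eq_bigr => a _; rewrite exprMn.
  by move/negbT/mulfI; apply; rewrite mulrBl SE mul1r subrr mulr0.
move=> nlt; case: (ltngtP n p.-1) => [lt|gt|->].
- case: n lt {nlt} => [|n] lt; last by rewrite small // oppr0.
  rewrite (eq_bigr (fun=> 1)) => [|a _]; last by rewrite expr0.
  by rewrite oppr0 sumr_const card_Fp // pchar_Fp_0.
- rewrite oppr0; transitivity (\sum_(a : F) a ^+ (n - p.-1)).
    2: by apply: small; lia.
  apply: eq_bigr => a _; rewrite -{1}(subnKC (ltnW gt)) exprD expF_pred.
  case: eqVneq => [->|]; last by rewrite mul1r.
  by rewrite mul0r expr0n; case: eqP => //; lia.
- rewrite (bigD1 0) //= expF_pred eqxx add0r.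
  under eq_bigr => a a0 do rewrite expF_pred a0.
  rewrite sumr_const (eq_card (B := predC1 0)) // cardC1 card_Fp //.
  by apply/eqP; rewrite -subr_eq0 opprK natr1 prednK ?prime_gt0 // pchar_Fp_0.
Qed.

(** Represents the convolution of [P] and [Q]: expand Q(x - a) at [x] in powers of -a, multiply by
    P(a) and keep the terms a^(p-1), the only ones whose sum over [a] survives. The derivatives are
    the divided ones, so no factorial is inverted. *)
Definition conv_poly (P Q : {poly F}) : {poly F} :=
  - \sum_(i < size Q) ((-1) ^+ i * P`_(p.-1 - i)) *: Q^`N(i).

Lemma horner_conv_poly (P Q : {poly F}) (x : F) :
    (size P <= p)%N -> (size Q < p)%N ->
  \sum_(a : F) P.[a] * Q.[x - a] = (conv_poly P Q).[x].
Proof.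
move=> sP sQ; rewrite /conv_poly hornerN horner_sum.
transitivity (\sum_(a : F) \sum_(i < size Q) \sum_(l < p)
                 (P`_l * Q^`N(i).[x] * (-1) ^+ i) * a ^+ (l + i)).
  apply: eq_bigr => a _; rewrite (nderiv_taylor _ (mulrC _ _)) mulr_sumr.
  apply: eq_bigr => i _; rewrite (horner_coef_wide _ sP) mulr_suml.
  by apply: eq_bigr => l _; rewrite [(- a) ^+ i]exprNn exprD; ring.
(* The size bounds give l + i <= (p - 1) + (p - 2), within the range of [sum_expF]. *)
rewrite exchange_big -sumrN; apply: eq_bigr => /= i _; rewrite exchange_big /=.
have i1p : (i.+1 < p)%N := leq_ltn_trans (ltn_ord i) sQ.
have ip : (p.-1 - i < p)%N by have := prime_gt0 p_pr; lia.
rewrite (bigD1 (Ordinal ip)) //= [X in _ + X]big1 => [|l ne]; last first.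
  rewrite -mulr_sumr sum_expF; last by have := ltn_ord l; lia.
  case: eqP => [E|_]; last by rewrite oppr0 mulr0.
  by case/eqP: ne; apply: val_inj => /=; lia.
rewrite addr0 -mulr_sumr sum_expF; last by lia.
rewrite hornerZ; case: eqP => [_|]; last by lia.
by rewrite /= mulrN1; ring.
Qed.

Lemma coef_conv_poly (P Q : {poly F}) t :
  (conv_poly P Q)`_t =
  - \sum_(i < size Q) (-1) ^+ i * P`_(p.-1 - i) * (Q`_(i + t) *+ 'C(i + t, i)).
Proof.
rewrite coefN coef_sum; congr (- _); apply: eq_bigr => i _.
by rewrite coefZ coef_nderivn.
Qed.

End PrimeFieldSums.

(** * Class functions of a translation-invariant colouring of triples *)

Section TranslationInvariantColouring.
Local Open Scope ring_scope.
Variables (p : nat) (p_pr : prime p).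
Local Notation F := 'F_p.
Variables (C : finType) (col : F -> F -> F -> C).

Hypothesis col_shift : forall t x y z, col (x + t) (y + t) (z + t) = col x y z.
Hypothesis col_eq : forall x y z x' y' z',
  col x y z = col x' y' z' -> (x == z) = (x' == z').
Hypothesis col_swap12 : forall x y z x' y' z',
  col x y z = col x' y' z' -> col y x z = col y' x' z'.
Hypothesis col_diag : forall x y z x' y' z',
  col x y z = col x' y' z' -> col x x z = col x' x' z'.
Hypothesis col_count : forall x y z x' y' z',
  col x y z = col x' y' z' -> forall c1 c2 c3,
  #|[set a | [&& col a y z == c1, col x a z == c2 & col x y a == c3]]| =
  #|[set a | [&& col a y' z' == c1, col x' a z' == c2 & col x' y' a == c3]]|.

Implicit Types (f g : F -> F -> F -> F) (P q : {poly F}).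

Definition class_fun f := forall x y z x' y' z',
  col x y z = col x' y' z' -> f x y z = f x' y' z'.

Lemma class_fun_ext f g : (forall x y z, f x y z = g x y z) ->
  class_fun f -> class_fun g.
Proof. by move=> E Hf x y z x' y' z' /Hf; rewrite !E. Qed.

Lemma class_funC c : class_fun (fun _ _ _ => c).
Proof. by []. Qed.

Lemma class_funD f g : class_fun f -> class_fun g ->
  class_fun (fun x y z => f x y z + g x y z).
Proof.
by move=> Hf Hg x y z x' y' z' E; rewrite (Hf _ _ _ _ _ _ E) (Hg _ _ _ _ _ _ E).
Qed.

Lemma class_funM f g : class_fun f -> class_fun g ->
  class_fun (fun x y z => f x y z * g x y z).
Proof.
by move=> Hf Hg x y z x' y' z' E; rewrite (Hf _ _ _ _ _ _ E) (Hg _ _ _ _ _ _ E).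
Qed.

Lemma class_funX f n : class_fun f -> class_fun (fun x y z => f x y z ^+ n).
Proof. by move=> Hf x y z x' y' z' E; rewrite (Hf _ _ _ _ _ _ E). Qed.

Lemma class_fun_swap12 f : class_fun f -> class_fun (fun x y z => f y x z).
Proof. by move=> Hf x y z x' y' z' /col_swap12/Hf. Qed.

(** This is the analytic form of (C3): group the points [a] by the colours of the three triples
    obtained by substituting [a]. The summand is constant on each group, and the group sizes depend
    only on the colour of (x, y, z). *)
Lemma class_fun_sum f g : class_fun f -> class_fun g ->
  class_fun (fun x y z => \sum_a f x a z * g x y a).
Proof.
move=> Hf Hg x y z x' y' z' E.
pose key x y z a := (col a y z, col x a z, col x y a).
rewrite (partition_big (key x y z) predT) //.
rewrite [RHS](partition_big (key x' y' z') predT) //=.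
apply: eq_bigr => -[[c1 c2] c3] _.
pose S x y z :=
  [set a | [&& col a y z == c1, col x a z == c2 & col x y a == c3]].
have SE u v w a : (key u v w a == (c1, c2, c3)) = (a \in S u v w).
  by rewrite inE !xpair_eqE andbA.
rewrite (eq_bigl _ _ (SE x y z)) (eq_bigl _ _ (SE x' y' z')).
have cS : #|S x y z| = #|S x' y' z'| := col_count E c1 c2 c3.
have [S0|[a0 Sa0]] := set_0Vmem (S x y z).
  have S0' : S x' y' z' = set0 by apply/eqP; rewrite -cards_eq0 -cS S0 cards0.
  by rewrite S0 S0' !big_set0.
have cst u v w : (forall a, a \in S u v w ->
    f u a w * g u v a = f x a0 z * g x y a0).
  move: Sa0; rewrite inE => /and3P[_ /eqP E2 /eqP E3] a.
  rewrite inE => /and3P[_ /eqP E2' /eqP E3'].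
  rewrite (Hf u a w x a0 z) ?(Hg u v a x y a0) //; congruence.
rewrite (eq_bigr _ (cst x y z)) (eq_bigr _ (cst x' y' z')) !sumr_const.
by rewrite cS.
Qed.

Definition diff_class q := class_fun (fun x _ z => q.[z - x]).

Lemma diff_classC c : diff_class c%:P.
Proof. by apply: class_fun_ext (class_funC c) => x y z; rewrite hornerC. Qed.

Lemma diff_classD P q : diff_class P -> diff_class q -> diff_class (P + q).
Proof.
by move=> HP Hq; apply: class_fun_ext (class_funD HP Hq) => x y z; rewrite hornerD.
Qed.

Lemma diff_classZ c q : diff_class q -> diff_class (c *: q).
Proof.
move=> Hq; apply: class_fun_ext (class_funM (class_funC c) Hq) => x y z.
by rewrite hornerZ.
Qed.

Lemma diff_classX n q : diff_class q -> diff_class (q ^+ n).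
Proof.
by move=> Hq; apply: class_fun_ext (class_funX n Hq) => x y z; rewrite horner_exp.
Qed.

(** The sum of q(z - a) P(a - x) over [a] is, after shifting [a] by [x], the convolution evaluated
    at z - x. *)
Lemma diff_class_conv P q : (size P <= p)%N -> (size q < p)%N ->
  diff_class P -> diff_class q -> diff_class (conv_poly P q).
Proof.
move=> sP sq HP Hq.
have Hq' := class_fun_swap12 Hq; have := class_fun_sum Hq' HP.
apply: class_fun_ext => x y z; rewrite -horner_conv_poly //.
rewrite (reindex_inj (addIr x)); apply: eq_bigr => a _ /=.
by rewrite addrK mulrC; congr (_ * _.[_]); ring.
Qed.

(** This power is the indicator of x <> z, which the colour determines. *)
Lemma diff_class_Xpred : diff_class 'X^(p.-1).
Proof.
move=> x y z x' y' z' E; rewrite !hornerXn !expF_pred // !subr_eq0.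
by rewrite ![z == _]eq_sym ![z' == _]eq_sym (col_eq E).
Qed.

(* With d = deg q and P = q^j, j = (p-1) / d, the convolution of P and q is, up to
   the multiple - P_(p-1) q, a class function whose degree is d - i for the least
   0 < i < d such that P_(p-1-i) <> 0. If there is no such i, then d | p-1 and
   X P' - j d P = j q^(j-1) (X q' - d q) has degree at most (j-1) d, so that
   X q' - d q is constant and q is a X^d + c. *)
Lemma diff_class_monomial_ind n q : (size q <= n)%N -> (1 < size q < p)%N ->
  diff_class q -> exists2 k, (0 < k < p.-1)%N & diff_class 'X^k.
Proof.
elim: n q => [|n IH] q sqn /andP[s1 sp] Hq; first by lia.
have q0 : q != 0 by rewrite -size_poly_gt0; lia.
pose d := (size q).-1; have dE : size q = d.+1 by rewrite /d; lia.
have qd : q`_d != 0 by have := lead_coefE q; rewrite -/d => <-; rewrite lead_coef_eq0.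
have d0 : (0 < d)%N by lia.
pose j := (p.-1 %/ d)%N; pose P := q ^+ j.
have P0 : P != 0 by rewrite expf_neq0.
have sP : size P = (j * d).+1.
  have := size_exp q j; rewrite -/P dE /= mulnC => <-.
  by rewrite prednK // size_poly_gt0.
have jd : (p.-1 = j * d + p.-1 %% d)%N := divn_eq _ _.
have Pjd : P`_(j * d) != 0.
  by have := lead_coefE P; rewrite sP /= => <-; rewrite lead_coef_eq0.
have sPp : (size P <= p)%N by lia.
have HP : diff_class P by apply: diff_classX.
have [/existsP ex|/existsPn nex] :=
    boolP [exists i : 'I_d, (0 < i)%N && (P`_(p.-1 - i) != 0)].
  have ex' : exists i, [&& (0 < i)%N, (i < d)%N & P`_(p.-1 - i) != 0].
    by case: ex => i /andP[i0 Pi]; exists (i : nat); rewrite i0 ltn_ord.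
  case: (ex_minnP ex') => i /and3P[i0 id Pi] imin {ex ex'}.
  pose r := conv_poly P q + P`_(p.-1) *: q.
  have rE t : r`_t = - \sum_(1 <= l < d.+1)
      (-1) ^+ l * P`_(p.-1 - l) * (q`_(l + t) *+ 'C(l + t, l)).
    rewrite coefD coef_conv_poly coefZ dE.
    rewrite -(big_mkord xpredT (fun l => (-1) ^+ l * P`_(p.-1 - l) *
       (q`_(l + t) *+ 'C(l + t, l)))) big_ltn // expr0 mul1r subn0 add0n bin0.
    by rewrite mulr1n opprD addrAC addNr add0r.
  have qbig t : (d < t)%N -> q`_t = 0 by move=> dt; rewrite nth_default // dE.
  have rsz : (size r <= d)%N.
    apply/leq_sizeP=> t dt; rewrite rE big1_seq ?oppr0 // => l.
    rewrite mem_index_iota => /andP[_ /andP[l0 ld]].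
    by rewrite qbig ?mul0rn ?mulr0 //; lia.
  (* Only l = i contributes: smaller [l] vanish by minimality of [i], larger ones reach past the
     degree of [q]. *)
  have rdi : r`_(d - i) != 0.
    rewrite rE oppr_eq0 (big_cat_nat (n := i)) //=; last by lia.
    rewrite big1_seq ?add0r => [|l]; last first.
      rewrite mem_index_iota => /andP[_ /andP[l0 li]].
      have [->|Pl] := eqVneq P`_(p.-1 - l) 0; first by rewrite mulr0 mul0r.
      by have := imin l; rewrite l0 (ltn_trans li id) Pl leqNgt li => /(_ isT).
    rewrite big_ltn; last by lia.
    rewrite big1_seq ?addr0 => [|l]; last first.
      rewrite mem_index_iota => /andP[_ /andP[li ld]].
      by rewrite qbig ?mul0rn ?mulr0 //; lia.
    rewrite subnKC; last by lia.
    rewrite -mulr_natr !mulf_neq0 ?signr_eq0 //.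
    by apply: binF_neq0; lia.
  apply: (IH r); first by lia.
    have : (d - i < size r)%N by rewrite ltnNge; apply: contra rdi => /leq_sizeP->.
    by lia.
  by apply: diff_classD; [apply: diff_class_conv | apply: diff_classZ].
have {nex} Pz i : (0 < i < d)%N -> P`_(p.-1 - i) = 0.
  by case/andP=> i0 id; have := nex (Ordinal id); rewrite i0 /= => /negPn/eqP.
(* A nonzero remainder of p - 1 modulo [d] would be an admissible index in [Pz], and the leading
   coefficient of [P] would vanish. *)
have dj : (p.-1 = j * d)%N.
  rewrite jd; have [->|m0] := posnP (p.-1 %% d)%N; first by rewrite addn0.
  case/eqP: Pjd; have <- : (p.-1 - p.-1 %% d = j * d)%N by rewrite {1}jd addnK.
  by apply: Pz; rewrite m0 ltn_mod.
have [j' jE] : exists j', j = j'.+1.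
  by case: j dj {P P0 sP jd Pjd sPp HP Pz} => [|j']; [lia | exists j'].
pose w := 'X * q^`() - d%:R *: q.
have wE t : w`_t = (t%:R - d%:R) * q`_t.
  rewrite coefB coefXM coefZ coef_deriv mulrBl; congr (_ - _).
  by case: t => [|t] /=; rewrite ?mul0r // mulr_natl.
have Pw : 'X * P^`() - (j * d)%:R *: P = (j%:R * q ^+ j') * w.
  rewrite /P deriv_exp jE /= /w mulrBr -!mul_polyC exprS natrM rmorphM /=.
  rewrite !rmorph_nat -mulr_natl. ring.
have LE t : ('X * P^`() - (j * d)%:R *: P)`_t = (t%:R - (j * d)%:R) * P`_t.
  rewrite coefB coefXM coefZ coef_deriv mulrBl; congr (_ - _).
  by case: t => [|t] /=; rewrite ?mul0r // mulr_natl.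
(* Strictly between degrees j'd and jd the coefficients of [P] vanish by [Pz]; at jd the factor t -
   jd vanishes. *)
have sL : (size ('X * P^`() - (j * d)%:R *: P)%R <= (j' * d).+1)%N.
  apply/leq_sizeP=> t lt; rewrite LE.
  have [->|tn] := eqVneq t (j * d)%N; first by rewrite subrr mul0r.
  have [ht|ht] := leqP t (j * d).
    rewrite -(subKn ht) -dj Pz ?mulr0 // dj jE.
    by move: ht tn lt; rewrite jE mulSn; lia.
  by rewrite nth_default ?mulr0 // sP.
have jn0 : (j%:R : F) != 0.
  by apply: natF_neq0 => //; rewrite {1}jE /=; have := leq_pmulr j d0; lia.
have sw : (size w <= 1)%N.
  have [->|w0] := eqVneq w 0; first by rewrite size_poly0.
  have qj0 : q ^+ j' != 0 by rewrite expf_neq0.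
  move: sL; rewrite Pw -mulrA -polyC_natr mul_polyC size_scale // size_mul //.
  have -> : size (q ^+ j') = (j' * d).+1.
    have := size_exp q j'; rewrite dE /= mulnC => <-.
    by rewrite prednK // size_poly_gt0.
  by rewrite addSn /= -[(j' * d).+1]addn1 leq_add2l.
exists d; first by rewrite d0; lia.
have -> : 'X^d = (q`_d)^-1 *: (q + (- q`_0)%:P).
  apply/polyP=> t; rewrite coefXn coefZ coefD coefC.
  have [->|td] := eqVneq t d; first by rewrite gtn_eqF // addr0 mulVf.
  case: t td => [|t] td; first by rewrite subrr mulr0.
  (* For 0 < t < d the coefficient (t - d) q_t of [w] is 0, while t - d is nonzero mod p. *)
  rewrite addr0; have [lt|gt|] := ltngtP t.+1 d.
  - have : w`_t.+1 = 0 by rewrite nth_default // (leq_trans sw).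
    rewrite wE => /eqP; rewrite mulf_eq0 => /orP[|/eqP->]; last by rewrite mulr0.
    by rewrite subr_eq0 => /eqP E; have := natF_inj p_pr _ _ E; lia.
  - by rewrite [q`_t.+1]nth_default ?mulr0 // dE.
  - by move/eqP: td.
by apply: diff_classZ; apply: diff_classD => //; apply: diff_classC.
Qed.

(** Interpolate the indicator [h] of the colour of (0, 0, z0) and add the multiple of X^(p-1) that
    lowers the degree below p - 1. On nonzero arguments this only adds a constant, so the values at
    [z0] and [z1] still differ and the polynomial is not constant. *)
Lemma diff_class_monomial (z0 z1 : F) :
    z0 != 0 -> z1 != 0 -> col 0 0 z0 <> col 0 0 z1 ->
  exists2 k, (0 < k < p.-1)%N & diff_class 'X^k.
Proof.
move=> z00 z10 ne; have p1 := prime_gt1 p_pr.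
pose h t : F := (col 0 0 t == col 0 0 z0)%:R.
(* [T a] is 1 at [a] and 0 elsewhere; its leading term is -X^(p-1). *)
pose T (a : F) : {poly F} := 1 - ('X - a%:P) ^+ p.-1.
pose q : {poly F} := \sum_(a : F) h a *: (T a + 'X^(p.-1)).
have hE t : q.[t] = h t + (\sum_a h a) * t ^+ p.-1.
  rewrite horner_sum mulr_suml (bigD1 t) //= [in RHS](bigD1 t) //= addrA.
  rewrite hornerZ /T !hornerE subrr expr0n gtn_eqF; last by lia.
  rewrite subr0 mulrDr mulr1; congr (_ + _); apply: eq_bigr => a na.
  rewrite !hornerE expF_pred // subr_eq0 eq_sym na subrr add0r //.
have Hq : diff_class q.
  have Hh : class_fun (fun x y z => h (z - x)).
    move=> x y z x' y' z' /col_diag E; congr ((_ == _)%:R).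
    by rewrite -(col_shift x) -[RHS](col_shift x') !add0r !subrK.
  have := class_funD Hh (class_funM (class_funC (\sum_a h a)) diff_class_Xpred).
  by apply: class_fun_ext => x y z; rewrite hE hornerXn.
have sq : (size q <= p.-1)%N.
  apply: (leq_trans (size_sum _ _ _)); apply/bigmax_leqP=> a _.
  apply: (leq_trans (size_scale_leq _ _)); apply/leq_sizeP=> t pt.
  rewrite /T coefD coefB coef1 coefXn gtn_eqF; last by lia.
  have sX : size (('X - a%:P) ^+ p.-1) = p by rewrite size_exp_XsubC; lia.
  have [->|nt] := eqVneq t p.-1.
    have := monic_exp p.-1 (monicXsubC a); rewrite monicE lead_coefE sX => /eqP->.
    by rewrite sub0r addNr.
  by rewrite nth_default ?subrr ?addr0 // sX; lia.
apply: (@diff_class_monomial_ind p.-1 q) => //; apply/andP; split; last by lia.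
rewrite ltnNge; apply/negP=> /size1_polyC qc.
have qE t : q.[t] = q`_0 by rewrite {1}qc hornerC.
have := hE z0; rewrite qE -(qE z1) hE !expF_pred // z00 z10 /h eqxx.
move/eqP; rewrite (inj_eq (addIr _)) (introF eqP (nesym ne)).
by rewrite eq_sym oner_eq0.
Qed.

(** * Binary forms of degree [k] and their coefficientwise algebra *)

Section Forms.
Variable k : nat.
Hypotheses (k_bounds : (0 < k < p.-1)%N) (Xk : diff_class 'X^k).

Implicit Types (c e : nat -> F).

Definition form c x y z : F :=
  \sum_(b < k.+1) c b * (y - x) ^+ b * (z - x) ^+ (k - b).

Definition form_class c := class_fun (form c).

Lemma form_class_ext c e : (forall b, (b <= k)%N -> c b = e b) ->
  form_class c -> form_class e.
Proof.
move=> E; apply: class_fun_ext => x y z; apply: eq_bigr => b _.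
by rewrite E // -ltnS.
Qed.

Lemma form_classD c e : form_class c -> form_class e ->
  form_class (fun b => c b + e b).
Proof.
move=> Hc He; apply: class_fun_ext (class_funD Hc He) => x y z.
by rewrite -big_split; apply: eq_bigr => b _; rewrite !mulrDl.
Qed.

Lemma form_classZ a c : form_class c -> form_class (fun b => a * c b).
Proof.
move=> Hc; apply: class_fun_ext (class_funM (class_funC a) Hc) => x y z.
by rewrite mulr_sumr; apply: eq_bigr => b _; rewrite !mulrA.
Qed.

(* The weight (a - x)^(p-1-k) kills every cross term, because the power sums
   over F_p vanish off the exponent p-1. *)
Lemma form_classM c e : form_class c -> form_class e ->
  form_class (fun b => c b * e b).
Proof.
move=> Hc He; case/andP: k_bounds => k0 kp.
(* Raise X^k to the power p - 2: k(p - 2) = (p - 1 - k) + (p - 1)(k - 1), and nonzero elements have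
   (p-1)-th power 1. At 0 both exponents are positive. *)
have Xpk : class_fun (fun x _ z => (z - x) ^+ (p.-1 - k)).
  have := class_funX (p - 2) Xk; apply: class_fun_ext => x _ z.
  rewrite hornerXn -exprM; have [->|n0] := eqVneq (z - x) 0.
    by rewrite !expr0n !gtn_eqF // ?muln_gt0 ?k0; lia.
  have -> : (k * (p - 2) = p.-1 - k + p.-1 * k.-1)%N.
    have [a kE] : exists a, k = a.+1 by exists k.-1; lia.
    have [u pE] : exists u, p.-1 = (k + u)%N by exists (p.-1 - k)%N; lia.
    have -> : (p - 2 = a + u)%N by lia.
    by rewrite pE kE; nia.
  by rewrite exprD exprM expF_pred // n0 expr1n mulr1.
have := class_funM (class_funC (-1)) (class_fun_sum Hc (class_funM Xpk He)).
apply: class_fun_ext => x y z; rewrite (reindex_inj (addIr x)) /=.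
(* The exponent of [a] is p - 1 + b - b', below 2(p - 1) because k < p - 1; it equals p - 1 exactly
   when b = b'. *)
transitivity (- \sum_(b < k.+1) \sum_(b' < k.+1)
    c b * e b' * (z - x) ^+ (k - b) * (y - x) ^+ b' *
    \sum_(a : F) a ^+ (b + (p.-1 - k) + (k - b'))).
  rewrite mulN1r; congr (- _); transitivity (\sum_(a : F) \sum_(b < k.+1)
      \sum_(b' < k.+1) c b * e b' * (z - x) ^+ (k - b) * (y - x) ^+ b' *
                       a ^+ (b + (p.-1 - k) + (k - b'))).
    apply: eq_bigr => a _; rewrite addrK /form mulr_suml; apply: eq_bigr => b _.
    rewrite !mulr_sumr; apply: eq_bigr => b' _.
    by rewrite addrK !exprD; ring.
  rewrite exchange_big; apply: eq_bigr => b _; rewrite exchange_big.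
  by apply: eq_bigr => b' _; rewrite mulr_sumr.
rewrite -sumrN; apply: eq_bigr => b _.
have kb := ltn_ord b; rewrite (bigD1 b) //= [X in _ + X]big1 => [|b' ne].
  rewrite sum_expF //; last by lia.
  case: eqP => [_|]; last by lia.
  by rewrite /= mulrN1 addr0 opprK; ring.
have kb' := ltn_ord b'; rewrite sum_expF //; last by lia.
case: eqP => [E|_]; last by rewrite oppr0 mulr0.
by case/eqP: ne; apply: val_inj => /=; lia.
Qed.

Lemma form_classX c n : form_class (fun=> 1) -> form_class c ->
  form_class (fun b => c b ^+ n).
Proof.
move=> H1 Hc; elim: n => [|n IH]; first by apply: form_class_ext H1.
by apply: form_class_ext (form_classM Hc IH) => b _; rewrite exprS.
Qed.

(** Coefficients of (z - y)^k = ((z - x) - (y - x))^k. *)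
Definition signed_bin b : F := (-1) ^+ b * 'C(k, b)%:R.

Lemma form_class_signed_bin : form_class signed_bin.
Proof.
have := class_fun_swap12 Xk; apply: class_fun_ext => x y z.
rewrite hornerXn -[z - y](_ : (z - x) - (y - x) = _); last by ring.
rewrite exprBn; apply: eq_bigr => b _; rewrite /signed_bin -mulr_natr; ring.
Qed.

Lemma signed_bin_neq0 b : (b <= k)%N -> signed_bin b != 0.
Proof.
move=> bk; rewrite mulf_neq0 ?signr_eq0 //; apply: binF_neq0 => //.
by case/andP: k_bounds; lia.
Qed.

(** The unit of the algebra is the (p-1)-th coefficientwise power of [signed_bin], whose entries up
    to [k] are all nonzero. *)
Lemma form_class1 : form_class (fun=> 1).
Proof.
case/andP: k_bounds => k0 kp.
have H n : form_class (fun b => signed_bin b ^+ n.+1).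
  elim: n => [|n IH]; first exact: form_class_signed_bin.
  by apply: form_class_ext (form_classM form_class_signed_bin IH).
apply: form_class_ext (H p.-2) => b bk; rewrite prednK; last by lia.
by rewrite expF_pred // signed_bin_neq0.
Qed.

(** The indicator of a level set is 1 - (c - a)^(p-1), a polynomial in [c] within the unital
    algebra. *)
Lemma form_class_level c a : form_class c ->
  form_class (fun b => (c b == a)%:R).
Proof.
move=> Hc; have H1 := form_class1.
have := form_classD H1 (form_classZ (-1) (form_classX p.-1 H1
          (form_classD Hc (form_classZ (- a) H1)))).
apply: form_class_ext => b _; rewrite mulr1 expF_pred // subr_eq0 mulN1r.
by case: eqP; rewrite ?subr0 ?subrr.
Qed.

(** Coefficients of the form after exchanging x and y: y - x changes sign and z - y is expanded as
    (z - x) - (y - x). *)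
Definition base_swap c a : F :=
  (-1) ^+ a * \sum_(b < a.+1) c b * 'C(k - b, a - b)%:R.

Lemma form_class_base_swap c : form_class c -> form_class (base_swap c).
Proof.
move/class_fun_swap12; apply: class_fun_ext => x y z; rewrite /form.
transitivity (\sum_(b < k.+1) \sum_(a < k.+1 | (b <= a)%N)
  (-1) ^+ a * (c b * 'C(k - b, a - b)%:R) * (y - x) ^+ a * (z - x) ^+ (k - a)).
  apply: eq_bigr => b _; have bk : (b <= k)%N by rewrite -ltnS.
  rewrite -[z - y](_ : (z - x) - (y - x) = _); last by ring.
  rewrite [(_ - _ - _) ^+ _]exprBn mulr_sumr.
  rewrite -(big_mkord (fun a => b <= a)%N (fun a => (-1) ^+ a *
    (c b * 'C(k - b, a - b)%:R) * (y - x) ^+ a * (z - x) ^+ (k - a))).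
  rewrite (big_cat_nat (n := b)) //=; last by rewrite ltnW.
  rewrite [X in _ = X + _]big_nat_cond [X in _ = X + _]big_pred0 => [|a].
    2: by lia.
  rewrite add0r -[X in index_iota X _]add0n big_addn subSn // big_mkord.
  rewrite [RHS]big_mkcond.
  apply: eq_bigr => a _ /=; rewrite leq_addl addnK [(a + b)%N]addnC subnDA.
  rewrite -[x - y]opprB [(- (y - x)) ^+ b]exprNn !exprD -mulr_natr.
  by ring.
under eq_bigr => b _ do rewrite big_mkcond.
rewrite exchange_big; apply: eq_bigr => a _ /=; rewrite -big_mkcond /base_swap.
rewrite mulr_sumr !mulr_suml (big_ord_widen_cond k.+1 xpredT (fun b => (-1) ^+ a *
  (c b * 'C(k - b, a - b)%:R) * (y - x) ^+ a * (z - x) ^+ (k - a))) //.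
Qed.

Lemma signed_bin1 : signed_bin 1 = - k%:R.
Proof. by rewrite /signed_bin expr1 bin1 mulN1r. Qed.

(** The bound k < p - 1 excludes k = -1 mod p. *)
Lemma natF_k1_neq0 : (k.+1%:R : F) != 0.
Proof. by apply: natF_neq0 => //; case/andP: k_bounds; lia. Qed.

(* The only candidates that the values at the two smallest indices 1 < b cannot
   rule out are b = 0 mod p and b = 2, the latter forcing k = -1 mod p. *)
Lemma signed_bin_base_swap_neq b : (1 < b <= k)%N ->
    signed_bin b = signed_bin 1 ->
  (-1) ^+ b * ('C(k.-1, b.-1)%:R + 1) <> -1 :> F.
Proof.
case/andP: k_bounds => k0 kp /andP[b1 bk]; rewrite signed_bin1 => sb.
have kn0 : (k%:R : F) != 0 by apply: natF_neq0 => //; lia.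
(* Absorption: k C(k - 1, b - 1) = b C(k, b), then use [sb] and cancel [k]. *)
have E : (-1) ^+ b * 'C(k.-1, b.-1)%:R = - b%:R :> F.
  apply: (mulfI kn0); rewrite mulrCA -natrM mul_bin_diag prednK; last by lia.
  by rewrite natrM mulrCA -/(signed_bin b) sb; ring.
(* The equation reads -b + (-1)^b = -1: odd [b] gives b = 0 and even [b] gives b = 2 in the
   field. *)
rewrite mulrDr E mulr1 -signr_odd; case: (boolP (odd b)) => ob /=.
  move/eqP; rewrite expr1 -subr_eq0 opprK subrK oppr_eq0.
  by apply/negP/natF_neq0 => //; lia.
rewrite expr0 => /eqP; rewrite -subr_eq0 opprK -addrA addrC subr_eq0 => /eqP.
move/(@natF_inj _ p_pr 2 b _ _) => b2; have {b2} b2 : b = 2%N by rewrite -b2; lia.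
move: sb; rewrite b2 /signed_bin sqrrN expr1n mul1r => sb.
have : k.+1%:R = 0 :> F; last by apply/eqP/natF_k1_neq0.
(* For b = 2, [sb] says C(k, 2) = -k, so k(k - 1) + 2k = k(k + 1) vanishes. *)
apply: (mulfI kn0); rewrite mulr0.
have : (2 * 'C(k, 2))%:R = 2%:R * (- k%:R) :> F by rewrite natrM sb.
have -> : (2 * 'C(k, 2) = k * k.-1)%N by rewrite -(mul_bin_diag k 1) bin1.
move=> h; have : k%:R * k.-1%:R + 2%:R * k%:R = 0 :> F.
  by rewrite -natrM h mulrN addNr.
move=> <-; rewrite -!natrM -natrD; congr (_%:R); nia.
Qed.

(** Induction on the size of an index set [S] containing 1 whose indicator gives a class function.
    Keep in [S'] the indices of [S] on which [signed_bin] and the base swap of that indicator agree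
    with their values at 1. If [S'] equals [S], then 0 is not in [S] because 1 <> -k, and the next
    index after 1 is excluded by [signed_bin_base_swap_neq]. *)
Lemma form_class_delta1 : form_class (fun b => (b == 1%N)%:R).
Proof.
case/andP: k_bounds => k0 kp.
suff ind n (S : pred nat) : (#|[set b : 'I_k.+1 | S b]| <= n)%N -> S 1%N ->
    form_class (fun b => (S b)%:R) -> form_class (fun b => (b == 1%N)%:R).
  exact: (ind _ xpredT (leqnn _) isT form_class1).
elim: n S => [|n IH] S cS S1 HS.
  move: cS; rewrite leqn0 cards_eq0 => /eqP/setP/(_ (inord 1)).
  by rewrite !inE inordK // S1.
pose e b : F := (S b)%:R.
pose S' b :=
  [&& S b, signed_bin b == signed_bin 1 & base_swap e b == base_swap e 1].
have HS' : form_class (fun b => (S' b)%:R).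
  have := form_classM HS (form_classM
    (form_class_level (signed_bin 1) form_class_signed_bin)
    (form_class_level (base_swap e 1) (form_class_base_swap HS))).
  by apply: form_class_ext => b _; rewrite /S' -!natrM !mulnb.
have [/existsP[b /andP[Sb nS'b]]|/existsPn nex] :=
    boolP [exists b : 'I_k.+1, S b && ~~ S' b].
  apply: (IH S') => //; last by rewrite /S' S1 !eqxx.
  rewrite -ltnS (leq_trans _ cS) //; apply: proper_card; apply/properP; split.
    by apply/subsetP=> a; rewrite !inE => /and3P[].
  by exists b; rewrite inE.
have SS' b : (b <= k)%N -> S b -> S' b.
  rewrite -ltnS => bk Sb; have := nex (Ordinal bk).
  by rewrite /= Sb /= negbK.
have S0 : S 0%N = false.
  apply/negP=> /(SS' _ (leq0n _))/and3P[_ + _].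
  rewrite signed_bin1 /signed_bin bin0 mulr1 expr0 -subr_eq0 opprK.
  by rewrite addrC natr1 (negPf natF_k1_neq0).
have [/existsP ex|/existsPn nex'] :=
    boolP [exists b : 'I_k.+1, S b && (b != 1%N :> nat)]; last first.
  apply: form_class_ext HS => b; rewrite -ltnS => bk.
  have := nex' (Ordinal bk); rewrite /= negb_and negbK.
  by have [->|_] := eqVneq b 1%N; rewrite ?S1 // orbF => /negPf->.
have ex' : exists b, [&& (b <= k)%N, S b & b != 1%N].
  by case: ex => b /andP[Sb b1]; exists (b : nat); rewrite -ltnS ltn_ord Sb.
case: (ex_minnP ex') => b /and3P[bk Sb b1] bmin.
have b1' : (1 < b)%N by case: b b1 Sb {bk bmin} => [|[]] //; rewrite S0.
have /and3P[_ /eqP sb /eqP] := SS' _ bk Sb.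
have -> : base_swap e 1 = -1.
  rewrite /base_swap expr1 big_ord_recl big_ord1 /= /e S0 S1 mul0r add0r.
  by rewrite bin0 !mulr1.
(* By minimality of [b], only 1 and [b] lie in [S] among the indices up to [b]. *)
have -> : base_swap e b = (-1) ^+ b * ('C(k.-1, b.-1)%:R + 1).
  congr (_ * _); rewrite big_ord_recr /= subnn bin0 mulr1 {2}/e Sb; congr (_ + _).
  rewrite (bigD1 (Ordinal b1')) //= {1}/e S1 mul1r !subn1 big1 ?addr0 // => a na.
  suff -> : e a = 0 by rewrite mul0r.
  rewrite /e; case: (boolP (S a)) => // Sa.
  have := bmin a; rewrite Sa (leq_trans (ltnW (ltn_ord a)) bk) /= leqNgt ltn_ord.
  by move=> /(_ na).
by case/(@signed_bin_base_swap_neq b); rewrite ?b1'.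
Qed.
End Forms.

(** The form with coefficients concentrated at index 1 is (y - x)(z - x)^(k-1), which for x <> z is
    injective in [y]. *)
Theorem col_fixed_pair_inj (z0 z1 : F) :
    z0 != 0 -> z1 != 0 -> col 0 0 z0 <> col 0 0 z1 ->
  forall x y y' z, x != z -> col x y z = col x y' z -> y = y'.
Proof.
move=> z00 z10 ne x y y' z xz E.
have [k kb Xk] := diff_class_monomial z00 z10 ne.
have k0 : (1 < k.+1)%N by case/andP: kb.
have := form_class_delta1 kb Xk E; rewrite /form.
have fE u : \sum_(b < k.+1) (b == 1%N :> nat)%:R * (u - x) ^+ b *
      (z - x) ^+ (k - b) = (u - x) * (z - x) ^+ k.-1.
  rewrite (bigD1 (Ordinal k0)) //= mul1r expr1 subn1 big1 ?addr0 // => b nb.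
  by rewrite (_ : (b == 1%N :> nat) = false) ?mul0r //; apply: negPf nb.
rewrite !fE => /mulIf h; apply: (addIr (- x)); apply: h.
by rewrite expf_neq0 // subr_eq0 eq_sym.
Qed.

End TranslationInvariantColouring.

(** * Triples and equivalence relations on three indices *)

Local Notation o0 := (Ordinal (isT : 0 < 3)).
Local Notation o1 := (Ordinal (isT : 1 < 3)).
Local Notation o2 := (Ordinal (isT : 2 < 3)).

Lemma ord3_ind (P : 'I_3 -> Prop) : P o0 -> P o1 -> P o2 -> forall i, P i.
Proof.
move=> P0 P1 P2 [[|[|[|m]]] lt] //; rewrite (bool_irrelevance lt isT) //.
Qed.

(** The default value of [nth] supplies the third coordinate. *)
Definition tri (T : Type) (x y z : T) : triple T :=
  [ffun i : 'I_3 => nth z [:: x; y] i].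

Lemma tri_eta (T : Type) (t : triple T) : t = tri (t o0) (t o1) (t o2).
Proof. by apply/ffunP; apply: ord3_ind; rewrite ffunE. Qed.

(** Two inequivalent indices outside the class of [o0] would make three classes. Hence [e] is the
    kernel of a map with values in {o0, o2}, to which (C2) applies. *)
Lemma two_class_equivalenceE (e : rel 'I_3) : equivalence_rel e ->
    #|equivalence_partition e [set: 'I_3]| <= 2 ->
  forall i j, e i j = ((if e o0 i then o0 else o2) == (if e o0 j then o0 else o2)).
Proof.
move=> eqe card2.
have e_refl i : e i i by case: (eqe i i i).
have e_left i j l : e i j -> e i l = e j l by case: (eqe i j l) => _; apply.
have e_sym i j : e i j = e j i.
  by apply/idP/idP=> h; [rewrite -(e_left _ _ i h) | rewrite -(e_left _ _ j h)].
move=> i j; case: ifP => hi; case: ifP => hj; rewrite ?eqxx.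
- by rewrite -(e_left _ _ j hi).
- by rewrite -(e_left _ _ j hi) hj.
- by rewrite e_sym -(e_left _ _ i hj) hi.
apply: contraTT card2 => nij; rewrite -ltnNge.
pose B a := [set b in [set: 'I_3] | e a b].
have BB a b : B a = B b -> e a b by move/setP/(_ b); rewrite !inE e_refl.
have card3 : #|[set B o0; B i; B j]| = 3.
  rewrite setUC cardsU1 cards2 !inE.
  have /eqP/negPf-> : B j <> B o0 by move=> /BB; rewrite e_sym hj.
  have /eqP/negPf-> : B j <> B i by move=> /BB; rewrite e_sym (negPf nij).
  by have /eqP-> : B o0 <> B i by move=> /BB; rewrite hi.
apply: (@leq_trans #|[set B o0; B i; B j]|); first by rewrite card3.
apply: subset_leq_card; apply/subsetP=> X; rewrite !inE -orbA.
by case/or3P=> /eqP->; apply: imset_f.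
Qed.

(** * The classes of a ternary coherent configuration as colours *)

Section TernaryConfiguration.
Variables (T : finType) (XX : {set {set triple T}}).
Hypothesis hcc : ternary_cc XX.
Implicit Types (x y z a b : T) (t u : triple T).

Definition tclass t := pblock XX t.

Lemma tclass_in t : tclass t \in XX.
Proof.
by case: hcc => /and3P[/eqP cov _ _] _ _ _; apply: pblock_mem; rewrite cov inE.
Qed.

Lemma mem_tclass t : t \in tclass t.
Proof. by case: hcc => /and3P[/eqP cov _ _] _ _ _; rewrite mem_pblock cov inE. Qed.

Lemma tclassE X t : X \in XX -> t \in X -> tclass t = X.
Proof. by case: hcc => /and3P[_ triv _] _ _ _; apply: def_pblock. Qed.

Lemma tclass_eqE X t : X \in XX -> (tclass t == X) = (t \in X).
Proof.
move=> PX; apply/eqP/idP=> [<-|]; [exact: mem_tclass | exact: tclassE].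
Qed.

Lemma tclass_rho t u i j : tclass t = tclass u -> (t i == t j) = (u i == u j).
Proof.
case: hcc => _ hC1 _ _ E; have := hC1 _ (tclass_in t) t u (mem_tclass t).
by rewrite {1}E mem_tclass => /(_ isT i j).
Qed.

Lemma tclass_tmap s t u : tclass t = tclass u ->
  tclass (tmap s t) = tclass (tmap s u).
Proof.
case: hcc => _ _ hC2 _ E; have inX := hC2 _ (tclass_in t) s.
have m v : v \in tclass t -> tclass (tmap s v) = tmap_set s (tclass t).
  by move=> vt; apply: tclassE inX _; apply: imset_f.
have ut : u \in tclass t by rewrite E mem_tclass.
by rewrite (m t (mem_tclass t)) (m u ut).
Qed.

(** If some [Y i] is not a class, both sets are empty; otherwise this is (C3). *)
Lemma tclass_count t u (Y : 'I_3 -> {set triple T}) : tclass t = tclass u ->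
  #|[set a | [forall i, tclass (tsubst t i a) == Y i]]| =
  #|[set a | [forall i, tclass (tsubst u i a) == Y i]]|.
Proof.
case: hcc => _ _ _ hC3 E.
have [/forallP YX|/forallPn[i nYi]] := boolP [forall i, Y i \in XX]; last first.
  have Z v : [set a | [forall i, tclass (tsubst v i a) == Y i]] = set0.
    apply/setP=> a; rewrite !inE; apply/forallP=> /(_ i)/eqP Yi.
    by rewrite -Yi tclass_in in nYi.
  by rewrite (Z t) (Z u).
have tu : u \in tclass t by rewrite E mem_tclass.
have := hC3 _ (tclass_in t) Y YX t u (mem_tclass t) tu.
by congr (_ = _); apply: eq_card => a; rewrite !inE; apply: eq_forallb => i;
  rewrite tclass_eqE.
Qed.

Definition tcol x y z := tclass (tri x y z).

Section Colour.
Variables (x y z x' y' z' : T).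
Hypothesis E : tcol x y z = tcol x' y' z'.

Lemma tcol_tmap s : tcol (tri x y z (s o0)) (tri x y z (s o1)) (tri x y z (s o2))
  = tcol (tri x' y' z' (s o0)) (tri x' y' z' (s o1)) (tri x' y' z' (s o2)).
Proof.
have := tclass_tmap s E.
by rewrite [tmap s (tri x y z)]tri_eta [tmap s (tri x' y' z')]tri_eta !ffunE.
Qed.

Lemma tcol_swap12 : tcol y x z = tcol y' x' z'.
Proof. by have := tcol_tmap (fun i => nth o2 [:: o1; o0] i); rewrite !ffunE. Qed.

Lemma tcol_swap23 : tcol x z y = tcol x' z' y'.
Proof. by have := tcol_tmap (fun i => nth o1 [:: o0; o2] i); rewrite !ffunE. Qed.

Lemma tcol_diag : tcol x x z = tcol x' x' z'.
Proof. by have := tcol_tmap (fun i => nth o2 [:: o0; o0] i); rewrite !ffunE. Qed.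

Lemma tcol_eq : (x == z) = (x' == z').
Proof. by have := tclass_rho o0 o2 E; rewrite !ffunE. Qed.

Lemma tcol_count c1 c2 c3 :
  #|[set a | [&& tcol a y z == c1, tcol x a z == c2 & tcol x y a == c3]]| =
  #|[set a | [&& tcol a y' z' == c1, tcol x' a z' == c2 & tcol x' y' a == c3]]|.
Proof.
have := tclass_count (fun i => nth c3 [:: c1; c2] i) E.
have SE (u v w : T) : [set a | [forall i, tclass (tsubst (tri u v w) i a) ==
      nth c3 [:: c1; c2] i]] =
    [set a | [&& tcol a v w == c1, tcol u a w == c2 & tcol u v a == c3]].
  apply/setP=> a; rewrite !inE.
  have -> : tcol a v w = tclass (tsubst (tri u v w) o0 a).
    by congr tclass; apply/ffunP; apply: ord3_ind; rewrite !ffunE.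
  have -> : tcol u a w = tclass (tsubst (tri u v w) o1 a).
    by congr tclass; apply/ffunP; apply: ord3_ind; rewrite !ffunE.
  have -> : tcol u v a = tclass (tsubst (tri u v w) o2 a).
    by congr tclass; apply/ffunP; apply: ord3_ind; rewrite !ffunE.
  apply/forallP/and3P=> [H|[H0 H1 H2]]; last exact: ord3_ind.
  by split; [apply: (H o0) | apply: (H o1) | apply: (H o2)].
by rewrite !SE.
Qed.

(** The point [a] itself makes the count on the left positive, hence also the one on the right. *)
Lemma tcol_extend a : exists a', [/\ tcol a y z = tcol a' y' z',
  tcol x a z = tcol x' a' z' & tcol x y a = tcol x' y' a'].
Proof.
have := tcol_count (tcol a y z) (tcol x a z) (tcol x y a).
have [S0|[a' Sa'] _] := set_0Vmem [set b | [&& tcol b y' z' == tcol a y z,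
    tcol x' b z' == tcol x a z & tcol x' y' b == tcol x y a]].
  rewrite S0 cards0 => /eqP; rewrite cards_eq0 => /eqP/setP/(_ a).
  by rewrite !inE !eqxx.
by exists a'; move: Sa'; rewrite inE => /and3P[/eqP-> /eqP-> /eqP->].
Qed.
End Colour.

Lemma tclass_tact t (f : {perm T}) : f \in cc_aut XX -> tclass (tact t f) = tclass t.
Proof.
rewrite inE => /forall_inP/(_ _ (tclass_in t))/eqP E.
by apply: tclassE (tclass_in t) _; rewrite -E; apply: imset_f (mem_tclass t).
Qed.

Lemma mem_cc_aut (f : {perm T}) :
  (forall x y z, tcol (f x) (f y) (f z) = tcol x y z) -> f \in cc_aut XX.
Proof.
move=> H; rewrite inE; apply/forall_inP=> X PX.
rewrite eqEcard card_setact leqnn andbT; apply/subsetP=> _ /imsetP[t Xt ->].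
rewrite -tclass_eqE // -(tclassE PX Xt); apply/eqP.
transitivity (tcol (f (t o0)) (f (t o1)) (f (t o2))).
  by congr tclass; apply/ffunP; apply: ord3_ind; rewrite !ffunE.
by rewrite H /tcol -tri_eta.
Qed.

(** * From determinacy over a pair to automorphisms *)

Section FixedPair.
Hypothesis tcol_inj : forall x y y' z, x != z -> tcol x y z = tcol x y' z -> y = y'.

(** The map [f] matches points by their colour over (x, z) and over (x', z'). Colours are preserved
    first on triples (x, a, z), then on triples containing [x], then on all triples, by extending
    with (C3) and identifying the new point by [tcol_inj]. *)
Lemma cc_aut_extend x y z x' y' z' : x != z -> tcol x y z = tcol x' y' z' ->
  exists2 f, f \in cc_aut XX & [/\ f x = x', f y = y' & f z = z'].
Proof.
move=> xz E; have xz' : x' != z' by rewrite -(tcol_eq E).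
have [f fP] : exists f : T -> T, forall a, tcol x a z = tcol x' (f a) z'.
  apply: (@fin_all_exists T (fun=> T) (fun a b => tcol x a z = tcol x' b z')).
  move=> a; have [a' [_ Ea _]] := tcol_extend E a.
  by exists a'.
have f_inj : injective f.
  by move=> a b Eab; apply: (tcol_inj xz); rewrite !fP Eab.
have fy : f y = y' by apply: (tcol_inj xz'); rewrite -fP.
have fx : f x = x'.
  apply/eqP; rewrite eq_sym; have := tcol_eq (tcol_swap23 (fP x)).
  by rewrite eqxx => <-.
have fz : f z = z'.
  have := tcol_eq (tcol_swap12 (fP z)); rewrite eqxx => /esym/eqP//.
have f2 a b : tcol x a b = tcol x' (f a) (f b).
  have [b' [_ Eb ->]] := tcol_extend (fP a) b.
  by rewrite (_ : b' = f b) //; apply: (tcol_inj xz'); rewrite -Eb fP.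
have f3 a b c : tcol a b c = tcol (f a) (f b) (f c).
  (* The pair (x', f b) can determine a point only if b <> x; for b = x, [f2] already applies. *)
  have [->|xb] := eqVneq b x; first by rewrite fx; apply: tcol_swap12.
  have [a' [-> _ Ea]] := tcol_extend (f2 b c) a.
  rewrite (_ : a' = f a) //; apply: (@tcol_inj x' a' (f a) (f b)).
    by rewrite -fx (inj_eq f_inj) eq_sym.
  by apply: tcol_swap23; rewrite -Ea f2.
exists (perm f_inj); last by rewrite !permE.
by apply: mem_cc_aut => a b c; rewrite !permE -f3.
Qed.

Hypothesis cc_aut_trans : forall x y, exists2 f, f \in cc_aut XX & f x = y.

(** Some pair of distinct coordinates can be moved to the outer positions, unless all three agree;
    transitivity settles that case. *)
Lemma tclass_orbit t u : tclass t = tclass u ->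
  exists2 f, f \in cc_aut XX & tact t f = u.
Proof.
rewrite (tri_eta t) (tri_eta u) => E.
have triP (f : {perm T}) a b c a' b' c' : [/\ f a = a', f b = b' & f c = c' :> T] ->
    tact (tri a b c) f = tri a' b' c'.
  by case=> <- <- <-; apply/ffunP; apply: ord3_ind; rewrite !ffunE.
have [e02|n02] := eqVneq (t o0) (t o2); last first.
  by have [f fA fE] := cc_aut_extend n02 E; exists f => //; apply: triP.
have [e01|n01] := eqVneq (t o0) (t o1); last first.
  have [f fA [f0 f2 f1]] := cc_aut_extend n01 (tcol_swap23 E).
  by exists f => //; apply: triP.
have := tcol_eq E; have := tcol_eq (tcol_swap23 E).
rewrite -e02 -e01 eqxx => /esym/eqP <- /esym/eqP <-.
have [f fA f0] := cc_aut_trans (t o0) (u o0).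
by exists f => //; apply: triP.
Qed.

(** The group is the full automorphism group: its orbits lie in classes by definition and fill them
    by [tclass_orbit]. *)
Lemma schurian_of_fixed_pair : schurian XX.
Proof.
have orbE t : orbit (triple_action T) (cc_aut XX) t = tclass t.
  apply/setP=> u; apply/orbitP/idP=> [[f fA <-]|].
    by rewrite -(tclass_tact t fA) mem_tclass.
  move/(tclassE (tclass_in t))/esym/tclass_orbit=> [f fA fE]; by exists f.
exists (cc_aut_group XX); apply/setP=> X; apply/idP/imsetP=> [PX|[t _ ->]].
  have [X0|[t Xt]] := set_0Vmem X.
    by case: hcc => /and3P[_ _] /negP[]; rewrite -X0.
  by exists t; rewrite ?inE // orbE (tclassE PX Xt).
by rewrite orbE tclass_in.
Qed.
End FixedPair.

(** Otherwise all (x, x, z) with x <> z form one class. Every triple whose relation has at most two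
    classes is the image of such a triple under a map of indices, so by (C2) each relation gets
    exactly one class. *)
Lemma two_pair_classes : 1 < #|T| -> ~ assoc_scheme_on_triples XX ->
  exists x z x' z', [/\ x != z, x' != z' & tcol x x z <> tcol x' x' z'].
Proof.
move=> T2 nas.
have [/existsP[[[x z] [x' z']]] /and3P[xz xz' /eqP ne]|/existsPn nex] :=
    boolP [exists w : (T * T) * (T * T), [&& w.1.1 != w.1.2, w.2.1 != w.2.2 &
      tcol w.1.1 w.1.1 w.1.2 != tcol w.2.1 w.2.1 w.2.2]].
  by exists x, z, x', z'.
have same x z x' z' : x != z -> x' != z' -> tcol x x z = tcol x' x' z'.
  move=> xz xz'; have := nex ((x, z), (x', z')).
  by rewrite /= xz xz' /= negbK => /eqP.
case: nas => e eqe card2; pose s i := if e o0 i then o0 else o2.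
have eE i j : e i j = (s i == s j) := two_class_equivalenceE eqe card2 i j.
have e0 : e o0 o0 by case: (eqe o0 o0 o0).
have neq_ex x : exists z, x != z.
  have [z zx|nz] := pickP (predC1 x); first by exists z; rewrite eq_sym.
  by move: T2; rewrite (cardD1 x) inE (eq_card0 (A := [predD1 T & x])) // => z;
     rewrite inE; have := nz z; rewrite /= => ->.
have /card_gt0P[a _] : 0 < #|T| by apply: ltnW.
have [b ab] := neq_ex a.
exists (tclass (tmap s (tri a a b))); split.
  split=> [|t tX i j]; first exact: tclass_in.
  rewrite /rho (@tclass_rho t (tmap s (tri a a b))); last first.
    exact: tclassE (tclass_in _) tX.
  rewrite eE /s !ffunE; case: ifP => _; case: ifP => _ //=; rewrite ?eqxx //.
  - exact: negPf.
  - by rewrite eq_sym (negPf ab).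
move=> X [PX rX]; have [X0|[t Xt]] := set_0Vmem X.
  by case: hcc => /and3P[_ _] /negP[]; rewrite -X0.
have tE i j : (t i == t j) = (s i == s j) by rewrite -eE -(rX t Xt).
have s0 : s o0 = o0 by rewrite /s e0.
(* [c] is the value of [t] on the class not containing [o0], or any other point if that class is
   empty. *)
have [c c0 cE] : exists2 c, t o0 != c & forall i, s i = o2 -> t i = c.
  have [j /eqP sj|nj] := pickP (fun i => s i == o2); last first.
    have [c tc] := neq_ex (t o0); exists c => // i si.
    by have := nj i; rewrite si eqxx.
  exists (t j) => [|i si]; first by rewrite tE s0 sj.
  by apply/eqP; rewrite tE si sj.
have tE' : t = tmap s (tri (t o0) (t o0) c).
  apply/ffunP=> i; rewrite !ffunE; case: (boolP (e o0 i)) => h.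
    have si : s i = o0 by rewrite /s h.
    by rewrite si /=; apply/eqP; rewrite tE si s0.
  have si : s i = o2 by rewrite /s (negPf h).
  by rewrite (cE i si) si.
rewrite -(tclassE PX Xt) tE'; apply: tclass_tmap; exact: same.
Qed.

End TernaryConfiguration.

(** * Transport to the prime field *)

Lemma card_preim_bij (S T : finType) (phi : S -> T) (P : pred T) :
  bijective phi -> #|[set a | P (phi a)]| = #|[set b | P b]|.
Proof.
case=> psi phiK psiK; rewrite -(card_imset _ (can_inj phiK)); apply: eq_card => b.
rewrite inE; apply/imsetP/idP=> [[a + ->]|Pb]; first by rewrite inE.
by exists (psi b); rewrite ?inE psiK.
Qed.

(** Label the point c^x(o) by [x], for a generator [c]; by orbit-stabiliser its order is |T|, so
    exponents live modulo p. *)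
Lemma regular_cyclic_labelling (T : finType) (C : {group {perm T}}) :
    prime #|T| -> cyclic C -> acts_regularly C ->
  exists2 phi : 'F_#|T| -> T, bijective phi &
    forall t, exists2 g, g \in C & forall x, phi (x + t)%R = g (phi x).
Proof.
move=> Tp /cyclicP[c CE] [Ctrans Creg].
have /card_gt0P[o _] := prime_gt0 Tp.
have oc : #[c]%g = #|T|.
  rewrite orderE -CE -(card_orbit_stab 'P C o) (Creg o) cards1 muln1.
  by rewrite (atransP Ctrans) ?inE // cardsT.
have cX : (c ^+ #|T| = 1)%g by rewrite -oc expg_order.
have cC i : (c ^+ i)%g \in C by rewrite CE mem_cycle.
pose phi (x : 'F_#|T|) := (c ^+ x)%g o.
have phiD x t : phi (x + t)%R = (c ^+ t)%g (phi x).
  (* The modulus displayed is the internal one of ['F_p]; reducing by it is harmless since c^p =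
     1. *)
  have cm i : (c ^+ (i %% (Zp_trunc (pdiv #|T|)).+2) = c ^+ i)%g.
    by apply: expg_mod; rewrite Fp_cast.
  by rewrite /phi /= cm expgD permM.
exists phi; last by move=> t; exists (c ^+ t)%g.
apply: inj_card_bij; last by rewrite card_Fp.
move=> x y E; apply/eqP; rewrite -subr_eq0; apply/eqP.
(* This power fixes [phi y], so it is trivial by regularity, and p divides a representative smaller
   than p. *)
have : (c ^+ (x - y)%R)%g \in ('C_C[phi y | 'P])%g.
  rewrite inE cC; apply/astab1P.
  by rewrite [LHS](_ : _ = phi (y + (x - y))%R) ?phiD // -phiD addrC subrK.
rewrite Creg inE -order_dvdn oc => d; apply: val_inj => /=.
have lt : (x - y)%R < #|T| by rewrite -[X in _ < X](Fp_cast Tp).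
by apply/eqP; move: d; apply: contraTT; rewrite -lt0n => h; rewrite gtnNdvd.
Qed.

Theorem theorem1p1 (Omega : finType) (XX : {set {set triple Omega}})
    (hprime : prime #|Omega|)
    (hcc : ternary_cc XX)
    (hcirc : circulant XX)
    (hnas : ~ assoc_scheme_on_triples XX) :
  schurian XX.
Proof.
have [C [CA Ccyc Creg]] := hcirc.
have [phi phi_bij phiD] := regular_cyclic_labelling hprime Ccyc Creg.
have [psi phiK psiK] := phi_bij.
have [x [z [x' [z' [xz xz' ne]]]]] := two_pair_classes hcc (prime_gt1 hprime) hnas.
pose col a b c := tcol XX (phi a) (phi b) (phi c).
have col_shift t a b c : col (a + t)%R (b + t)%R (c + t)%R = col a b c.
  have [g gC gE] := phiD t; rewrite /col !gE /tcol.
  rewrite -(tclass_tact hcc (tri (phi a) (phi b) (phi c)) (subsetP CA _ gC)).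
  by congr (tclass _ _); apply/ffunP; apply: ord3_ind; rewrite !ffunE.
have col_count a b c a' b' c' : col a b c = col a' b' c' -> forall c1 c2 c3,
    #|[set u | [&& col u b c == c1, col a u c == c2 & col a b u == c3]]| =
    #|[set u | [&& col u b' c' == c1, col a' u c' == c2 & col a' b' u == c3]]|.
  move=> E c1 c2 c3; have := tcol_count hcc E c1 c2 c3.
  by rewrite -!(card_preim_bij _ phi_bij).
have inj a b b' c : a != c -> col a b c = col a b' c -> b = b'.
  apply: (@col_fixed_pair_inj _ hprime _ col col_shift _ _ _
    col_count (psi z - psi x)%R (psi z' - psi x')%R).
  - by move=> ? ? ? ? ? ? E; have := tcol_eq hcc E; rewrite !(can_eq phiK).
  - by move=> ? ? ? ? ? ? E; apply: (tcol_swap12 hcc E).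
  - by move=> ? ? ? ? ? ? E; apply: (tcol_diag hcc E).
  - by rewrite subr_eq0 (can_eq psiK) eq_sym.
  - by rewrite subr_eq0 (can_eq psiK) eq_sym.
  (* Translating by [psi x] and [psi x'] carries the normalised triples back to (x, x, z) and (x',
     x', z'). *)
  - rewrite -(col_shift (psi x)) -[X in _ <> X](col_shift (psi x')).
    by rewrite !add0r !subrK /col !psiK.
apply: (schurian_of_fixed_pair hcc) => [u v v' w uw E|u v].
  rewrite -(psiK v) (inj (psi u) (psi v) (psi v') (psi w)) ?psiK //.
    by rewrite (can_eq psiK).
  by rewrite /col !psiK.
(* Translation by the difference of the labels is an automorphism taking [u] to [v]. *)
have [g gC gE] := phiD (psi v - psi u)%R.
exists g; first exact: subsetP gC.
by rewrite -{1}(psiK u) -gE addrC subrK psiK.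
Qed.
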